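(* Let $K$ be a field, let $n\ge m\ge 3$ be integers, and let $P\subset K[x_1,\dots,x_n]$ be a monomial prime. Then $P$ is an associated prime of $(I(H)^\vee)^2$ for some $m$-hypergraph $H$ of size $n$ (with vertex set $\{x_1,\dots,x_n\}$) if and only if $\operatorname{height}(P)\ge m$.
   Context: An $m$-hypergraph $H$ of size $n$ consists of a vertex set $\{x_1,\dots,x_n\}$ and an edge set $E$ whose elements are subsets of the vertex set with exactly $m$ distinct elements. The vertices are identified with the variables of $K[x_1,\dots,x_n]$. The edge ideal $I(H)$ is the ideal generated by the monomials $x_{i_1}\cdots x_{i_m}$ with $\{x_{i_1},\dots,x_{i_m}\}\in E$. Its Alexander dual is $I(H)^\vee=\bigcap_{\{x_{i_1},\dots,x_{i_m}\}\in E}(x_{i_1},\dots,x_{i_m})$ (an empty intersection being the whole ring, which has no associated primes). A monomial prime is a prime ideal generated by monomials, i.e. by a subset of the variables. An associated prime of an ideal $J$ of a ring $R$ means an associated prime of $R/J$. *)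

(* Defs.v *)
From mathcomp Require Import all_boot all_algebra.
From mathcomp Require Import boolp classical_sets.
From mathcomp Require Import mpoly.

Set Implicit Arguments.
Unset Strict Implicit.
Unset Printing Implicit Defensive.

Import GRing.Theory.
Local Open Scope ring_scope.
Local Open Scope classical_set_scope.

Section Ideals.
Variable R : comNzRingType.
Implicit Types (A I J P : set R) (k : nat).

(* Unlike [idealr_closed] of ring_quotient, this allows the unit ideal. *)
Definition ideal I : Prop :=
  I 0 /\ forall a u v, I u -> I v -> I (a * u + v).

Definition ideal_gen A : set R := smallest ideal A.

Definition ideal_mul I J : set R :=
  ideal_gen [set f * g | f in I & g in J].

(* [idealr_closed] includes properness: 1 is not in P. *)
Definition prime_ideal P : Prop :=
  idealr_closed (mem P) /\ prime_idealr_closed (mem P).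

(* P is a prime ideal and the annihilator of the class of some f in R / J. *)
Definition associated_prime J P : Prop :=
  prime_ideal P /\ exists f, P = [set r | J (r * f)].

(* There are prime ideals Q 0 < Q 1 < ... < Q k = P. *)
Definition prime_chain P k : Prop :=
  exists Q : nat -> set R,
    [/\ forall i, (i <= k)%N -> prime_ideal (Q i),
        forall i, (i < k)%N -> Q i `<` Q i.+1
      & Q k = P].

(* The height of P is the supremum, in the extended naturals, of the lengths
   of such chains; it is at least the natural number h iff some chain has
   length at least h. *)
Definition height_ge P (h : nat) : Prop :=
  exists2 k, (h <= k)%N & prime_chain P k.

End Ideals.

(* m-hypergraphs of size n; the vertex x_(i+1) is represented by i : 'I_n. *)
Record hypergraph (m n : nat) := Hypergraph {
  edges : {set {set 'I_n}};
  card_edge : forall e, e \in edges -> #|e| = m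
}.

Section MonomialIdeals.
Variables (K : fieldType) (n : nat).

Definition monomial_prime (P : set {mpoly K[n]}) : Prop :=
  prime_ideal P /\
  exists A : set 'X_{1..n}, P = ideal_gen [set 'X_[K, a] | a in A].

Definition var_ideal (S : {set 'I_n}) : set {mpoly K[n]} :=
  ideal_gen [set 'X_i | i in [set` S]].

(* The intersection over an empty edge set is the whole ring. *)
Definition edge_ideal_dual m (H : hypergraph m n) : set {mpoly K[n]} :=
  \bigcap_(e in [set` edges H]) var_ideal e.

End MonomialIdeals.

Arguments edge_ideal_dual K {n m} H.

(* Main.v *)
Require Import Defs.
From mathcomp Require Import all_boot all_algebra.
From mathcomp Require Import boolp classical_sets.
From mathcomp Require Import mpoly.
From mathcomp Require Import zify.

(** A monomial prime is the ideal [P_S] generated by the variables of a set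
    [S], and its height is [#|S|] ([height_var_ideal]). Let [J] be the dual of
    a hypergraph [H].

    If [P_S] is associated to [J ^ 2], it contains [J]. If [S] contained no
    edge, the product of the variables outside [S] would lie in [J], hence in
    [P_S], which is absurd; so [#|S| >= m] ([associated_prime_card]).

    Conversely, [J] is spanned by the monomials whose support is a vertex cover
    of [H], so the monomials of [J ^ 2] are those divisible by the product of
    the squarefree monomials of two covers. If all edges are in [S] and [f] is
    the squarefree monomial with support [B], it follows that [P_S] is the
    annihilator of [f] modulo [J ^ 2] as soon as [B] is not a disjoint union of
    two covers, but becomes a union of two covers sharing only [i] when a
    vertex [i] of [S] is added, counted twice if it was already in [B]
    ([associated_prime_crit]). If [#|S| = m], take [S] as the only edge and a
    single vertex for [B]. If [#|S| > m >= 3], take for [B] the vertices of an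
    odd cycle and for edges the edges of the cycle, padded to size [m] by
    vertices of [S :\: B] all of which are used ([exists_hypergraph]). An odd
    cycle has no proper 2-colouring, but has one with a single monochromatic
    edge, which can be chosen so that its padded edge contains [i]; adding [i]
    to the missing colour repairs it.

    The lower bound of the height of [P_S] is given by the primes generated by
    fewer and fewer variables. For the upper bound, a chain of primes ending
    in [P_S] is prolonged by adding the other variables, so it is enough that
    chains of primes of [K[x_1, ..., x_n]] have length at most [n]
    ([prime_chain_dim]). Choosing an element in each difference of successive
    primes of a chain gives algebraically independent elements
    ([chain_alg_indep]), whereas [n + 1] polynomials are dependent: their
    monomials with exponents less than [D] are [D ^ n.+1] elements of a space
    of dimension [O(D ^ n)] ([mpoly_dependent]). *)

Set Implicit Arguments.
Unset Strict Implicit.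
Unset Printing Implicit Defensive.

Import GRing.Theory.

(** * Ideals and prime ideals *)

Section Ideals.
Local Open Scope ring_scope.
Local Open Scope classical_set_scope.
Variable R : comNzRingType.
Implicit Types (A I J P : set R).

Lemma idealM I a u : ideal I -> I u -> I (a * u).
Proof. by case=> I0 IS Iu; rewrite -[_ * _]addr0; apply: IS. Qed.

Lemma idealD I u v : ideal I -> I u -> I v -> I (u + v).
Proof. by case=> I0 IS Iu Iv; rewrite -[u]mul1r; apply: IS. Qed.

Lemma idealB I u v : ideal I -> I u -> I v -> I (u - v).
Proof. by case=> I0 IS Iu Iv; rewrite addrC -mulN1r; apply: IS. Qed.

Lemma ideal_sum (T : eqType) (r : seq T) (F : T -> R) I :
  ideal I -> (forall x, x \in r -> I (F x)) -> I (\sum_(x <- r) F x).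
Proof.
move=> idI IF; rewrite big_seq; elim/big_ind: _ => //; first by case: idI.
by move=> u v; apply: idealD.
Qed.

Lemma ideal_gen_ideal A : ideal (ideal_gen A).
Proof.
split=> [J [[]]//|a u v gu gv J [idJ AJ]].
by case: (idJ) => _; apply; [apply: gu|apply: gv].
Qed.

Lemma ideal_gen_sub A J : ideal J -> A `<=` J -> ideal_gen A `<=` J.
Proof. by move=> idJ AJ; apply: smallest_sub. Qed.

Lemma mem_ideal_gen A : A `<=` ideal_gen A.
Proof. exact: sub_gen_smallest. Qed.

Lemma mem_ideal_mul I J f g : I f -> J g -> ideal_mul I J (f * g).
Proof. by move=> If Jg; apply: mem_ideal_gen; exists f => //; exists g. Qed.

Lemma prime_ideal_ideal P : prime_ideal P -> ideal P.
Proof.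
case=> -[P0 _ PS] _; split=> [|a u v Pu Pv]; first by rewrite inE in P0.
by apply/set_mem/PS; rewrite inE.
Qed.

Lemma prime_ideal_neq1 P : prime_ideal P -> ~ P 1.
Proof. by case=> -[_ /negP P1 _] _ ?; apply: P1; rewrite inE. Qed.

Lemma prime_idealM P u v : prime_ideal P -> P (u * v) -> P u \/ P v.
Proof.
case=> _ pP Puv; have /orP[]: (u \in P) || (v \in P) by apply: pP; rewrite inE.
  by rewrite inE; left.
by rewrite inE; right.
Qed.

Lemma prime_ideal_prod (T : Type) (r : seq T) (F : T -> R) P :
  prime_ideal P -> P (\prod_(x <- r) F x) -> exists x, P (F x).
Proof.
move=> pP; elim: r => [|x r IHr]; first by rewrite big_nil => /(prime_ideal_neq1 pP).
by rewrite big_cons => /(prime_idealM pP)[|/IHr//]; exists x.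
Qed.

Lemma prime_idealX P u k : prime_ideal P -> P (u ^+ k) -> P u.
Proof.
move=> pP; elim: k => [/(prime_ideal_neq1 pP)//|k IHk].
by rewrite exprS => /(prime_idealM pP)[].
Qed.

Lemma ker_prime_ideal (S : idomainType) (phi : {rmorphism R -> S}) :
  prime_ideal [set f | phi f = 0].
Proof.
split; first split.
- by rewrite inE /= rmorph0.
- by apply/negP; rewrite inE /= rmorph1 => /eqP; rewrite oner_eq0.
- move=> a u v; rewrite !inE /= => u0 v0.
  by rewrite rmorphD rmorphM u0 v0 mulr0 addr0.
move=> u v; rewrite !inE /= rmorphM => /eqP; rewrite mulf_eq0.
by case/orP=> /eqP uv0; apply/orP; [left|right]; rewrite inE.
Qed.

Lemma prime_chain_step P P' k :
  prime_ideal P' -> P `<` P' -> prime_chain P k -> prime_chain P' k.+1.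
Proof.
move=> pP' ltPP' [Q [pQ ltQ QP]].
exists (fun i => if (i <= k)%N then Q i else P'); split=> [i|i|].
- by rewrite leq_eqVlt => /orP[/eqP->|]; rewrite ?ltnn // ltnS => ik; rewrite ik; apply: pQ.
- rewrite ltnS => ik; rewrite ik; case: ltnP => [|ki]; first exact: ltQ.
  by rewrite (@anti_leq i k) ?ik // QP.
- by rewrite ltnn.
Qed.

End Ideals.

(** * Monomial ideals and ideals of variables *)

Section VarIdeals.
Local Open Scope ring_scope.
Local Open Scope classical_set_scope.
Variables (K : fieldType) (n : nat).
Local Notation V := (@var_ideal K n).
Implicit Types (S T : {set 'I_n}) (a b : 'X_{1..n}) (f g : {mpoly K[n]}).

(** The polynomials all of whose monomials have their exponent in [U]; this is
    an ideal, namely the monomial ideal with set of exponents [U], as soon as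
    [U] is closed under adding exponents. *)
Definition monomials_in (U : set 'X_{1..n}) : set {mpoly K[n]} :=
  [set f | forall a, a \in msupp f -> U a].

Lemma monomials_in_ideal (U : set 'X_{1..n}) :
  (forall a b, U a -> U (b + a)%MM) -> ideal (monomials_in U).
Proof.
move=> upU; split=> [a|c u v Uu Uv a]; first by rewrite msupp0.
move/msuppD_le; rewrite mem_cat => /orP[|/Uv//].
by case/msuppM_le/allpairsP=> -[x y] /= [_ /Uu Uy ->]; apply: upU.
Qed.

(** The exponents of the monomials divisible by some variable of [S] *)
Definition hits S : set 'X_{1..n} := [set a | exists2 i, i \in S & (0 < a i)%N].

Lemma hitsDl S a b : hits S a -> hits S (b + a)%MM.
Proof. by case=> i iS ai; exists i; rewrite // mnmDE ltn_addl. Qed.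

Lemma var_ideal_ideal S : ideal (V S).
Proof. exact: ideal_gen_ideal. Qed.

Lemma mem_var_ideal S i : i \in S -> V S 'X_i.
Proof. by move=> iS; apply: mem_ideal_gen; exists i. Qed.

Lemma hits_mpolyX S a : hits S a -> V S 'X_[a].
Proof.
case=> i iS ai; rewrite -(submK (_ : U_(i) <= a)%MM).
  by rewrite mpolyXD; apply: (idealM _ (var_ideal_ideal S)); apply: mem_var_ideal.
by apply/mnm_lepP=> j; rewrite mnm1E; case: eqP => // <-.
Qed.

Lemma var_ideal_monomials S : V S = monomials_in (hits S).
Proof.
apply/seteqP; split=> [|f Sf].
  apply: ideal_gen_sub; first by apply: monomials_in_ideal => a b; apply: hitsDl.
  move=> _ [i iS <-] a; rewrite msuppX inE => /eqP->.
  by exists i; rewrite // mnm1E eqxx.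
rewrite [f]mpolyE; apply: ideal_sum => [|a /Sf]; first exact: var_ideal_ideal.
by rewrite -mul_mpolyC => /hits_mpolyX; apply: idealM; apply: var_ideal_ideal.
Qed.

Lemma var_idealX S a : V S 'X_[a] <-> hits S a.
Proof.
split; last exact: hits_mpolyX.
by rewrite var_ideal_monomials; apply; rewrite msuppX inE.
Qed.

Lemma var_idealXU S i : V S 'X_i <-> i \in S.
Proof.
split; last exact: mem_var_ideal.
by move/var_idealX=> [j jS]; rewrite mnm1E; case: eqP => // ->.
Qed.

(** The ideal of the variables of [S] is the kernel of the substitution of
    zero for these variables. *)
Lemma var_ideal_prime S : prime_ideal (V S).
Proof.
pose z : n.-tuple {mpoly K[n]} := [tuple if i \in S then 0 else 'X_i | i < n].
suff -> : V S = [set f | f \mPo z = 0] by apply: ker_prime_ideal.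
apply/seteqP; split=> [|f /= f0].
  apply: ideal_gen_sub => [|_ [i iS <-]].
    exact: prime_ideal_ideal (ker_prime_ideal _).
  by rewrite /= comp_mpolyXU -tnth_nth tnth_mktuple iS.
rewrite -[f]subr0 -f0 [f in f - _]mpolyE comp_mpolyEX -sumrB.
have idS := var_ideal_ideal S.
apply: ideal_sum => // a _; rewrite -scalerBr -mul_mpolyC; apply: (idealM _ idS).
have [Sa|nSa] := pselect (hits S a).
  apply: (idealB idS); first exact: hits_mpolyX.
  case: Sa => i iS ai; rewrite comp_mpolyX (bigD1 i) //= tnth_mktuple iS.
  by rewrite expr0n -[_ == _]negbK -lt0n ai mul0r; exact: idS.1.
rewrite comp_mpolyX [X in X - _]mpolyXE_id [X in _ - X](eq_bigr (fun i => 'X_i ^+ a i)).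
  by rewrite subrr; exact: idS.1.
move=> i _; rewrite tnth_mktuple; case: ifP => // iS; case: (posnP (a i)) => [->//|ai].
by case: nSa; exists i.
Qed.

Lemma var_idealS S T : S \subset T -> V S `<=` V T.
Proof.
move=> /fintype.subsetP ST; apply: ideal_gen_sub; first exact: var_ideal_ideal.
by move=> _ [i iS <-]; apply: mem_var_ideal; apply: ST.
Qed.

Lemma var_ideal_proper S i : i \notin S -> V S `<` V (i |: S).
Proof.
move=> iS; rewrite properEneq; split; last by apply: var_idealS; apply: finset.subsetUr.
apply/eqP=> eqS; move: (negP iS); apply; apply/var_idealXU.
by rewrite eqS; apply: mem_var_ideal; rewrite finset.setU11.
Qed.

Lemma monomial_prime_var P : monomial_prime P -> exists S, P = V S.
Proof.
case=> pP [A defP]; have idP := prime_ideal_ideal pP.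
exists [set i | `[< P 'X_i >]]%SET; apply/seteqP; split; last first.
  by apply: ideal_gen_sub => // f [i]; rewrite /= inE => /asboolP Pi <-.
rewrite {1}defP; apply: ideal_gen_sub; first exact: var_ideal_ideal.
move=> _ [a Aa <-]; apply: hits_mpolyX.
have: P 'X_[a] by rewrite defP; apply: mem_ideal_gen; exists a.
apply: contraPP => nSa; rewrite mpolyXE_id => /(prime_ideal_prod pP)[i].
case: (posnP (a i)) => [->|ai]; first exact: prime_ideal_neq1.
by move/(prime_idealX pP) => Pi; apply: nSa; exists i; rewrite // inE; apply/asboolP.
Qed.

End VarIdeals.

(** * Heights *)

(** All sequences of [k] natural numbers less than [D]. *)
Fixpoint boxseq (D k : nat) : seq (seq nat) :=
  if k is k'.+1 then [seq a :: t | a <- iota 0 D, t <- boxseq D k']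
  else [:: [::]].

Lemma size_boxseq D k : size (boxseq D k) = D ^ k.
Proof. by elim: k => //= k IHk; rewrite size_allpairs size_iota IHk expnS. Qed.

Lemma uniq_boxseq D k : uniq (boxseq D k).
Proof.
elim: k => //= k IHk; apply: allpairs_uniq => //; first exact: iota_uniq.
by move=> [a t] [b u] _ _ [-> ->].
Qed.

Section Dimension.
Local Open Scope ring_scope.
Local Open Scope classical_set_scope.

(** The product of the powers of the elements of [z] with exponents [t];
    if the lengths differ, the longer sequence is truncated. *)
Fixpoint powprod (R : comNzRingType) (z : seq R) (t : seq nat) : R :=
  match z, t with
  | x :: z', a :: t' => x ^+ a * powprod z' t'
  | _, _ => 1
  end.

(** If [x] is in [Q1] but not in [Q0], a polynomial in [x] with value in [Q0]
    is zero, provided that only its zero coefficients lie in [Q1]: the lowest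
    coefficient lies in [Q1], and then [x] can be divided out. *)
Lemma coef_in_step (R : comNzRingType) (Q0 Q1 : set R) x D (G : nat -> R) :
  prime_ideal Q0 -> prime_ideal Q1 -> Q0 `<=` Q1 -> Q1 x -> ~ Q0 x ->
  (forall a, (a < D)%N -> Q1 (G a) -> G a = 0) ->
  Q0 (\sum_(a <- iota 0 D) x ^+ a * G a) ->
  forall a, (a < D)%N -> G a = 0.
Proof.
move=> p0 p1 Q01 Q1x Q0x; elim: D G => // D IHD G G0.
rewrite /= big_cons expr0 mul1r (iotaDl 1 0) big_map.
under eq_bigr do rewrite exprS -mulrA.
rewrite -mulr_sumr => Q0G.
have G00 : G 0%N = 0.
  apply: G0 => //; rewrite -[G _](addrK (x * \sum_(a <- iota 0 D) x ^+ a * G a.+1)).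
  apply: (idealB (prime_ideal_ideal p1)); first exact: Q01.
  by rewrite mulrC; apply: (idealM _ (prime_ideal_ideal p1)).
move: Q0G; rewrite G00 add0r => /(prime_idealM p0)[//|Q0G] [//|a].
by apply: (IHD (G \o succn)) => // b; exact: (G0 b.+1).
Qed.

Variables (K : fieldType) (n : nat).

(** Elements chosen in the successive differences of a chain of primes are
    algebraically independent, even modulo the first prime of the chain. *)
Lemma chain_alg_indep (z : seq {mpoly K[n]}) (Q : nat -> set {mpoly K[n]})
    D (c : seq nat -> K) :
  (forall i, (i <= size z)%N -> prime_ideal (Q i)) ->
  (forall i, (i < size z)%N ->
    [/\ Q i `<=` Q i.+1, Q i.+1 z`_i & ~ Q i z`_i]) ->
  Q 0%N (\sum_(t <- boxseq D (size z)) c t *: powprod z t) ->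
  forall t, t \in boxseq D (size z) -> c t = 0.
Proof.
elim: z Q c => [|x z IHz] Q c pQ zQ.
  rewrite /= big_seq1 => Qc t; rewrite inE => /eqP->.
  apply/eqP; apply: contraT => c0; case: (prime_ideal_neq1 (pQ 0%N isT)).
  rewrite -(scale1r 1) -(mulVf c0) -scalerA -mul_mpolyC.
  exact: (idealM _ (prime_ideal_ideal (pQ 0%N isT))).
have [Q01 Q1x Q0x] := zQ 0%N isT.
pose G a := \sum_(t <- boxseq D (size z)) c (a :: t) *: powprod z t.
have cG a : Q 1%N (G a) -> forall t, t \in boxseq D (size z) -> c (a :: t) = 0.
  by apply: (IHz (Q \o succn)) => i iz; [apply: pQ|apply: zQ].
rewrite /= big_allpairs_dep /= => Q0c.
have {Q0c}Q0G : Q 0%N (\sum_(a <- iota 0 D) x ^+ a * G a).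
  congr (Q _ _): Q0c; apply: eq_bigr => a _; rewrite mulr_sumr.
  by apply: eq_bigr => t _; rewrite scalerAr.
have G0 a : (a < D)%N -> G a = 0.
  apply: (@coef_in_step _ (Q 0%N) (Q 1%N) x) a => //; try exact: pQ.
  by move=> a _ /cG ca; rewrite /G big_seq big1 // => t tD; rewrite ca ?scale0r.
move=> _ /allpairsP[[a t] [/= aD tD ->]].
apply: cG => //; rewrite mem_iota add0n in aD.
by rewrite G0 //; exact: (prime_ideal_ideal (pQ 1%N isT)).1.
Qed.

Lemma msupp_powprod (d D : nat) (z : seq {mpoly K[n]}) t a :
  (forall x, x \in z -> (msize x <= d)%N) -> t \in boxseq D (size z) ->
  a \in msupp (powprod z t) -> (mdeg a <= size z * (D * d))%N.
Proof.
elim: z t a => [|x z IHz] t a zd /=.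
  by rewrite msupp1 [a \in _]inE => _ /eqP->; rewrite mdeg0.
move=> /allpairsP[[k u] [/= kD uD ->]] /msuppM_le/allpairsP[[b b'] [/= bx b'z ->]].
rewrite mdegD mulSn leq_add //; last first.
  by apply: IHz b'z => // y yz; apply: zd; rewrite inE yz orbT.
rewrite mem_iota add0n in kD.
suff: (mdeg b <= k * d)%N by move/leq_trans; apply; rewrite leq_mul2r (ltnW kD) orbT.
have xd : (msize x <= d)%N by apply: zd; rewrite mem_head.
elim: k b bx {kD b'z} => [|k IHk] b; first by rewrite msupp1 inE => /eqP->; rewrite mdeg0.
rewrite exprS => /msuppM_le/allpairsP[[e e'] [/= ex e'x ->]].
rewrite mdegD mulSn leq_add ?IHk // ltnW //.
exact: leq_trans (msize_mdeg_lt ex) xd.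
Qed.

(** A family of polynomials with all exponents less than [M] is linearly
    dependent if it has more than [M ^ n] members. *)
Lemma mpoly_dependent (T : eqType) (r : seq T) (F : T -> {mpoly K[n]}) M :
  uniq r -> (forall x a i, x \in r -> a \in msupp (F x) -> (a i < M)%N) ->
  (M ^ n < size r)%N ->
  exists c : T -> K, \sum_(x <- r) c x *: F x = 0 /\ exists2 x, x \in r & c x != 0.
Proof.
case: r => // x0 r0; set r := x0 :: r0 => ur FM szr.
pose mon (g : {ffun 'I_n -> 'I_M}) : 'X_{1..n} := [multinom (g i : nat) | i < n].
pose A := \matrix_(k < size r, j < #|{: {ffun 'I_n -> 'I_M}}|)
  (F (nth x0 r k))@_(mon (enum_val j)).
have : (0 < \rank (kermx A))%N.
  rewrite mxrank_ker subn_gt0 (leq_ltn_trans (rank_leq_col A)) //.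
  by rewrite card_ffun !card_ord.
rewrite lt0n mxrank_eq0 => /rowV0Pn[u /sub_kermxP uA u0].
have [k uk] : exists k, u 0 k != 0.
  apply/existsP; apply: contraNT u0; rewrite negb_exists => /forallP u0.
  by apply/eqP/rowP => k; rewrite mxE; apply/eqP; rewrite -[_ == _]negbK u0.
have rE (k' : 'I_(size r)) : inord (index (nth x0 r k') r) = k' by rewrite index_uniq // inord_val.
exists (fun x => u 0 (inord (index x r))); split; last first.
  by exists (nth x0 r k); rewrite ?mem_nth ?rE.
rewrite (big_nth x0) big_mkord; under eq_bigr do rewrite rE.
apply/mpolyP => a; rewrite mcoeff0 raddf_sum /=.
have [/existsP[g /eqP ag]|aM] := boolP [exists g, a == mon g].
  have := congr1 (fun B : 'M_(_, _) => B 0 (enum_rank g)) uA; rewrite !mxE => {2}<-.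
  by apply: eq_bigr => k' _; rewrite mcoeffZ mxE enum_rankK ag.
apply: big1 => k' _; rewrite mcoeffZ memN_msupp_eq0 ?mulr0 //.
apply: contra aM => akF; have aM i := FM _ _ i (@mem_nth _ x0 r k' (ltn_ord k')) akF.
by apply/existsP; exists [ffun i => Ordinal (aM i)]; apply/eqP/mnmP => i; rewrite mnmE ffunE.
Qed.

(** The Krull dimension of [K[x_1, ..., x_n]] is at most [n]. *)
Lemma prime_chain_dim (P : set {mpoly K[n]}) k : prime_chain P k -> (k <= n)%N.
Proof.
case=> Q [pQ ltQ _]; rewrite leqNgt; apply/negP => nk.
have /choice[y yQ] : forall i, exists y, (i < k)%N -> Q i.+1 y /\ ~ Q i y.
  move=> i; case: (ltnP i k) => [ik|]; last by exists 0.
  by case: (ltQ i ik) => _ /existsNP[y /not_implyP ?]; exists y.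
pose z := [seq y i | i <- iota 0 n.+1].
have sz : size z = n.+1 by rewrite size_map size_iota.
pose d := \max_(x <- z) msize x.
have zd x : x \in z -> (msize x <= d)%N by move=> xz; rewrite /d (big_rem x) //= leq_maxl.
(* The elements of [z] have degree at most [d], so [D] must satisfy
   [(n.+1 * (D * d) + 1) ^ n < D ^ n.+1]. *)
pose D := ((n.+1 * d).+1 ^ n).+1.
have D0 : (0 < D)%N by [].
have [||c [c0 [t tD /eqP]]] := @mpoly_dependent _ (boxseq D (size z)) (powprod z) (n.+1 * (D * d)).+1 (uniq_boxseq _ _).
- move=> t a i tD /(msupp_powprod zd tD); rewrite sz ltnS; apply: leq_trans.
  by rewrite mdegE (bigD1 i) //= leq_addr.
- rewrite size_boxseq sz expnSr; apply: (@leq_ltn_trans (D ^ n * (n.+1 * d).+1 ^ n)).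
    by rewrite -expnMn; case: {+}n => // n'; rewrite leq_exp2r //; nia.
  by rewrite ltn_pmul2l // expn_gt0.
apply; apply: (@chain_alg_indep z Q D c) => //.
- by move=> i; rewrite sz => ik; apply: pQ; apply: leq_trans nk.
- move=> i; rewrite sz => ik; have [//|Qy nQy] := yQ i; first exact: leq_trans nk.
  rewrite (nth_map 0%N) ?size_iota // nth_iota // add0n.
  by case: (ltQ i (leq_trans ik nk)).
by rewrite c0; apply: (prime_ideal_ideal (pQ 0%N _)).1.
Qed.

End Dimension.

Section Height.
Local Open Scope ring_scope.
Local Open Scope classical_set_scope.
Variables (K : fieldType) (n : nat).
Implicit Types (S : {set 'I_n}).
Local Notation V := (@var_ideal K n).

Lemma prime_chain_var S : prime_chain (V S) #|S|.
Proof.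
have [k kS] : exists k, #|S| = k by exists #|S|.
rewrite kS; elim: k S kS => [|k IHk] S kS.
  by exists (fun=> V S); split=> // i _; apply: var_ideal_prime.
have [i iS] : exists i, i \in S by apply/card_gt0P; rewrite kS.
rewrite -(finset.setD1K iS); apply: prime_chain_step (var_ideal_prime _ _) _ (IHk _ _).
  by apply: var_ideal_proper; rewrite !inE eqxx.
by move: kS; rewrite (cardsD1 i) iS => -[].
Qed.

(** A chain of primes ending in the ideal of the variables of [S] can be
    prolonged by adding the other variables one at a time. *)
Lemma prime_chain_var_le S k : prime_chain (V S) k -> (k <= #|S|)%N.
Proof.
have [d dS] : exists d, #|~: S| = d by exists #|~: S|.
elim: d S dS k => [|d IHd] S dS k chS.
  by have := cardsC S; rewrite dS addn0 card_ord => ->; apply: prime_chain_dim chS.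
have [i] : exists i, i \in ~: S by apply/card_gt0P; rewrite dS.
rewrite inE => iS.
have /IHd : #|~: (i |: S)| = d.
  by move: dS; rewrite (cardsD1 i) inE iS finset.setCU finset.setIC -finset.setDE => -[].
rewrite -ltnS => /(_ k.+1); rewrite cardsU1 iS; apply.
by apply: prime_chain_step (var_ideal_prime _ _) _ chS; apply: var_ideal_proper.
Qed.

Lemma height_var_ideal S h : height_ge (V S) h <-> (h <= #|S|)%N.
Proof.
split=> [[k hk /prime_chain_var_le]|hS]; first exact: leq_trans.
by exists #|S| => //; apply: prime_chain_var.
Qed.

End Height.

(** * Squares of Alexander duals *)

Section Dual.
Local Open Scope ring_scope.
Local Open Scope classical_set_scope.
Variables (K : fieldType) (n m : nat).
Implicit Types (S B C e : {set 'I_n}) (H : hypergraph m n).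
Local Notation V := (@var_ideal K n).
Local Notation J H := (edge_ideal_dual K H).

(** [C] meets every edge of [H]. *)
Definition vertex_cover H C := [forall e in edges H, C :&: e != finset.set0].

Lemma vertex_coverP H C :
  reflect (forall e, e \in edges H -> exists2 i, i \in C & i \in e) (vertex_cover H C).
Proof.
apply: (iffP forall_inP) => HC e /HC.
  by case/finset.set0Pn => i; rewrite inE => /andP[]; exists i.
by case=> i iC ie; apply/finset.set0Pn; exists i; rewrite inE iC.
Qed.

(** The exponent of the squarefree monomial with support [S] *)
Definition mset S : 'X_{1..n} := [multinom (i \in S : nat) | i < n].

(** The support of an exponent *)
Definition supp (a : 'X_{1..n}) : {set 'I_n} := [set i | (0 < a i)%N]%SET.

Lemma dual_monomials H : J H = monomials_in [set a | vertex_cover H (supp a)].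
Proof.
apply/seteqP; split=> f Jf.
  move=> a fa; apply/vertex_coverP => e He.
  have := Jf e He; rewrite var_ideal_monomials => /(_ a fa)[i ie ai].
  by exists i; rewrite // inE.
move=> e He; rewrite var_ideal_monomials => a /Jf/vertex_coverP/(_ e He)[i].
by rewrite inE => ai ie; exists i.
Qed.

Lemma dual_cover H C : vertex_cover H C -> J H 'X_[mset C].
Proof.
move=> HC; rewrite dual_monomials => a; rewrite msuppX inE => /eqP->.
congr (is_true (vertex_cover H _)): HC; apply/finset.setP => i.
by rewrite inE mnmE; case: (i \in C).
Qed.

Lemma dual_sq_monomials H f a : ideal_mul (J H) (J H) f -> a \in msupp f ->
  exists C C', [/\ vertex_cover H C, vertex_cover H C' & forall i, ((i \in C) + (i \in C') <= a i)%N].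
Proof.
pose U := [set a : 'X_{1..n} | exists C C', [/\ vertex_cover H C, vertex_cover H C' &
  forall i, ((i \in C) + (i \in C') <= a i)%N]].
suff JU : ideal_mul (J H) (J H) `<=` monomials_in U by move=> /JU Uf /Uf.
apply: ideal_gen_sub.
  apply: monomials_in_ideal => b c [C [C' [HC HC' leC]]]; exists C, C'; split=> // i.
  by rewrite mnmDE (leq_trans (leC i)) // leq_addl.
move=> _ [g Jg [h Jh <-]] c /msuppM_le/allpairsP[[b b'] [/= gb hb' ->]].
rewrite dual_monomials in Jg Jh.
exists (supp b), (supp b'); split=> [||i]; [exact: Jg|exact: Jh|].
by rewrite !inE mnmDE; apply: leq_add; [case: (b i)|case: (b' i)].
Qed.

Lemma associated_prime_card S H :
  associated_prime (ideal_mul (J H) (J H)) (V S) -> (m <= #|S|)%N.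
Proof.
case=> pS [f defS].
have [/existsP[e /andP[He eS]]|noe] := boolP [exists e in edges H, e \subset S].
  by rewrite -(card_edge He) subset_leq_card.
have Jg : J H 'X_[mset (~: S)].
  apply: dual_cover; apply/vertex_coverP => e He; have : ~~ (e \subset S).
    by apply: contra noe => eS; apply/existsP; exists e; rewrite He.
  by case/subsetPn => i ie iS; exists i; rewrite ?inE.
(* The square of an element of [J] kills [f], so it lies in [P_S]. *)
have : V S ('X_[mset (~: S)] * 'X_[mset (~: S)]).
  rewrite defS /= mulrC; apply: (idealM _ (ideal_gen_ideal _)).
  exact: mem_ideal_mul.
by case/(prime_idealM pS) => /var_idealX[i iS]; rewrite mnmE inE iS.
Qed.

(** A criterion for the ideal of the variables of [S] to be the annihilator of
    the squarefree monomial with support [B] modulo the square of the dual: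
    its multiples by monomials in the other variables are not in the square
    because [B] is not the disjoint union of two covers, but its multiple by a
    variable [i] of [S] is in it, because [C] and [B :\: C] with [i] added are
    covers. *)
Lemma associated_prime_crit H S B :
  (forall e, e \in edges H -> e \subset S) ->
  (forall C, C \subset B -> vertex_cover H C -> ~~ vertex_cover H (B :\: C)) ->
  (forall i, i \in S -> exists C, [/\ C \subset B, vertex_cover H C &
     vertex_cover H (i |: B :\: C)]) ->
  associated_prime (ideal_mul (J H) (J H)) (V S).
Proof.
move=> HS noC adC; split; first exact: var_ideal_prime.
exists 'X_[mset B]; apply/seteqP; split.
  apply: ideal_gen_sub => [|_ [i /adC[C [CB HC HC']] <-]] /=.
    split=> [|a u v /= Ju Jv]; first by rewrite /= mul0r; exact: (ideal_gen_ideal _).1.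
    by rewrite mulrDl -mulrA; apply: (ideal_gen_ideal _).2.
  rewrite -mpolyXD -(@submK _ (mset C + mset (i |: B :\: C)) (U_(i) + mset B)).
    rewrite mpolyXD; apply: (idealM _ (ideal_gen_ideal _)).
    by rewrite mpolyXD; apply: mem_ideal_mul; apply: dual_cover.
  apply/mnm_lepP => j; rewrite !mnmDE !mnmE !inE eq_sym.
  have := fintype.subsetP CB j.
  by case: (i == j); case: (j \in C); case: (j \in B) => //= /(_ isT).
move=> r /= Jr; rewrite var_ideal_monomials => a ra.
have /(dual_sq_monomials Jr)[C [C' [HC HC' leC]]] : (mset B + a)%MM \in msupp (r * 'X_[mset B]).
  by rewrite mcoeff_msupp mcoeffMX -mcoeff_msupp.
apply: contrapT => nSa.
(* As all edges are in [S], only the part in [S] of a cover matters, and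
   there the monomial has the exponents of [mset B]. *)
have coverI D : vertex_cover H D -> vertex_cover H (D :&: S).
  move=> /vertex_coverP HD; apply/vertex_coverP => e He; have [i iD ie] := HD e He.
  by exists i; rewrite // inE iD (fintype.subsetP (HS e He)).
have le1 i : i \in S -> ((i \in C) + (i \in C') <= (i \in B))%N.
  move=> iS; have := leC i; rewrite mnmDE mnmE; case: (posnP (a i)) => [->|ai].
    by rewrite addn0.
  by case: nSa; exists i.
have CB : C :&: S \subset B.
  apply/fintype.subsetP => i; rewrite inE => /andP[iC /le1]; rewrite iC.
  by case: (i \in B).
apply: (negP (noC _ CB (coverI _ HC))); apply/vertex_coverP => e.
case/(elimT (vertex_coverP _ _) (coverI _ HC')) => i.
rewrite inE => /andP[iC' iS] ie; exists i => //; have := le1 i iS.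
by rewrite !inE iC' iS; case: (i \in C); case: (i \in B).
Qed.

End Dual.

(** * Hypergraphs from odd cycles *)

(** The successor of [j] on the cycle [0, ..., 2 * k] *)
Definition cycle_next (k j : nat) : nat := if j == k.*2 then 0 else j.+1.

(** The colouring of the cycle [0, ..., 2 * k] in which the colours alternate
    except along the edge from [j0] to its successor, both of whose ends have
    the colour [true] *)
Definition cycle_color (j0 i : nat) : bool := (i <= j0) (+) odd i (+) odd j0.

Lemma cycle_color_next k j0 j : j0 <= k.*2 -> j <= k.*2 ->
  cycle_color j0 (cycle_next k j) = (j == j0) || ~~ cycle_color j0 j.
Proof.
rewrite /cycle_color /cycle_next => j0k jk; have := odd_double k.
case: (j =P k.*2) => [->|_] odd2k.
  rewrite odd2k leq0n; case: (ltngtP k.*2 j0) => [|_|<-]; first by rewrite ltnNge j0k.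
    by case: (odd j0).
  by rewrite odd2k.
by rewrite /=; case: (ltngtP j j0) => [_|_|->]; case: (odd _) => //; case: (odd _).
Qed.

(** An odd cycle has no proper colouring with two colours. *)
Lemma odd_cycle_color (k : nat) (c : nat -> bool) :
  (forall j, j <= k.*2 -> c (cycle_next k j) != c j) -> False.
Proof.
move=> cP; have cE j : j <= k.*2 -> c j = c 0 (+) odd j.
  elim: j => [|j IHj] jk; first by rewrite addbF.
  have := cP j (ltnW jk); rewrite /cycle_next ltn_eqF // IHj 1?ltnW //=.
  by case: (c j.+1); case: (c 0); case: (odd j).
have := cP k.*2 (leqnn _); rewrite /cycle_next eqxx (cE k.*2) // odd_double addbF.
by rewrite eqxx.
Qed.

Section OddCycle.
Variables (m n k : nat) (S : {set 'I_n}) (v : nat -> 'I_n) (W : nat -> {set 'I_n}).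
Implicit Types C e : {set 'I_n}.
Let B : {set 'I_n} := [set v j | j : 'I_k.*2.+1].
Hypothesis v_inj : forall i j, i <= k.*2 -> j <= k.*2 -> v i = v j -> i = j.
Hypothesis BS : B \subset S.
Hypothesis k_gt0 : 0 < k.
Hypothesis WS : forall j, W j \subset S :\: B.
Hypothesis card_W : forall j, #|W j|.+2 = m.
Hypothesis W_cover : forall i, i \in S :\: B -> exists2 j, j <= k.*2 & i \in W j.

Let edge j := v j |: (v (cycle_next k j) |: W j).

Let next_le j : j <= k.*2 -> cycle_next k j <= k.*2.
Proof. by rewrite /cycle_next leq_eqVlt; case: (j =P k.*2). Qed.

Let vB j : j <= k.*2 -> v j \in B.
Proof. by move=> jk; apply/imsetP; exists (Ordinal (jk : j < k.*2.+1)). Qed.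

Let WB j i : i \in W j -> (i \in B) = false.
Proof. by move/(fintype.subsetP (WS j)); rewrite inE => /andP[/negPf]. Qed.

Let card_edge_cycle (e : {set 'I_n}) :
  e \in [set edge j | j : 'I_k.*2.+1]%SET -> #|e| = m.
Proof.
case/imsetP=> -[j jk] _ ->; rewrite /edge /= !cardsU1 !inE -(card_W j).
have vW i : i <= k.*2 -> (v i \in W j) = false.
  by move=> ik; apply: contraTF (vB ik) => /WB->.
rewrite !vW ?next_le // orbF.
suff /negPf -> : v j != v (cycle_next k j) by [].
apply/eqP => /(v_inj jk (next_le jk)); rewrite /cycle_next.
by case: ifP => [/eqP->|_]; [move: k_gt0; case: k|move/n_Sn].
Qed.

(** The edges of the odd cycle [v 0, ..., v (2 * k)], each padded by the
    vertices of [W] to size [m] *)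
Definition odd_cycle_hypergraph : hypergraph m n := Hypergraph card_edge_cycle.

Lemma odd_cycle_edgeP e :
  reflect (exists2 j, j <= k.*2 & e = edge j) (e \in edges odd_cycle_hypergraph).
Proof.
apply: (iffP imsetP) => [[[j jk] _ ->]|[j jk ->]]; first by exists j.
by exists (Ordinal (jk : j < k.*2.+1)).
Qed.

Lemma odd_cycle_edgeS e : e \in edges odd_cycle_hypergraph -> e \subset S.
Proof.
case/odd_cycle_edgeP => j jk ->; apply/fintype.subsetP => i.
rewrite !inE => /orP[/eqP->|/orP[/eqP->|]].
- exact: (fintype.subsetP BS) (vB jk).
- exact: (fintype.subsetP BS) (vB (next_le jk)).
by move/(fintype.subsetP (WS j)); rewrite inE => /andP[].
Qed.

Lemma odd_cycle_no_cover C :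
  C \subset B -> vertex_cover odd_cycle_hypergraph C ->
  ~~ vertex_cover odd_cycle_hypergraph (B :\: C).
Proof.
move=> CB /vertex_coverP HC; apply/negP => /vertex_coverP HBC.
(* The vertices of padding are not in [B], so each edge of the cycle has one end
   in [C] and the other in [B :\: C]. *)
apply: (@odd_cycle_color k (fun j => v j \in C)) => j jk.
have ej : edge j \in edges odd_cycle_hypergraph by apply/odd_cycle_edgeP; exists j.
have [i iC] := HC _ ej; have [i' iBC] := HBC _ ej.
rewrite !inE => e' e.
have {}e : (i == v j) || (i == v (cycle_next k j)).
  by move: e; rewrite orbA => /orP[//|/WB]; rewrite (fintype.subsetP CB).
move: iBC; rewrite inE => /andP[i'C i'B].
have {}e' : (i' == v j) || (i' == v (cycle_next k j)).
  by move: e'; rewrite orbA => /orP[//|/WB]; rewrite i'B.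
case/orP: e iC => /eqP-> iC; case/orP: e' i'C => /eqP-> i'C; rewrite ?iC ?(negPf i'C) //.
  by rewrite iC in i'C.
by rewrite iC in i'C.
Qed.

Lemma odd_cycle_add_cover i : i \in S -> exists C, [/\ C \subset B,
  vertex_cover odd_cycle_hypergraph C & vertex_cover odd_cycle_hypergraph (i |: B :\: C)].
Proof.
move=> iS; have [j0 j0k ij0] : exists2 j0, j0 <= k.*2 & i \in edge j0.
  have [iB|iB] := boolP (i \in B).
    by case/imsetP: iB => -[j jk] _ ->; exists j; rewrite // setU11.
  have [|j jk iW] := W_cover (i := i); first by rewrite inE iB.
  by exists j; rewrite // !inE iW !orbT.
(* The vertices having the colour of both ends of the edge [j0]; this edge is
   the only one that the other colour misses. *)
pose C := [set v j | j : 'I_k.*2.+1 & cycle_color j0 j]%SET.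
have vC j : j <= k.*2 -> (v j \in C) = cycle_color j0 j.
  move=> jk; apply/imsetP/idP => [[[j' j'k]]|cj].
    by rewrite inE /= => cj' /(v_inj jk j'k)->.
  by exists (Ordinal (jk : j < k.*2.+1)); rewrite ?inE.
exists C; split.
- by apply/fintype.subsetP => _ /imsetP[j _ ->]; apply: vB; rewrite -ltnS.
- apply/vertex_coverP => _ /odd_cycle_edgeP[j jk ->].
  have [cj|cj] := boolP (cycle_color j0 j).
    by exists (v j); rewrite ?vC // setU11.
  exists (v (cycle_next k j)); last by rewrite !inE eqxx orbT.
  by rewrite vC ?next_le // cycle_color_next // cj orbT.
apply/vertex_coverP => _ /odd_cycle_edgeP[j jk ->].
have [->|jj0] := eqVneq j j0; first by exists i; rewrite // setU11.
have [cj|cj] := boolP (cycle_color j0 j); last first.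
  exists (v j); last by rewrite setU11.
  by rewrite !inE vC // cj vB ?orbT.
exists (v (cycle_next k j)); last by rewrite !inE eqxx orbT.
rewrite !inE vC ?next_le // cycle_color_next // (negPf jj0) cj vB ?next_le //.
by rewrite orbT.
Qed.

End OddCycle.

(** A set with [p] or [p + 1] elements is covered by subsets of [p] elements
    indexed by [0, ..., 2 * k]. *)
Lemma exists_padding n (Z : {set 'I_n}) p k : 0 < k -> 0 < p ->
  (#|Z| == p) || (#|Z| == p.+1) ->
  exists W : nat -> {set 'I_n}, [/\ forall j, W j \subset Z, forall j, #|W j| = p &
    forall z, z \in Z -> exists2 j, j <= k.*2 & z \in W j].
Proof.
move=> k0 p0 /orP[] /eqP Zp; first by exists (fun=> Z); split=> // z; exists 0.
have [z0 [z1 [z0Z z1Z z01]]] : exists z0 z1, [/\ z0 \in Z, z1 \in Z & z0 != z1].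
  by have /card_gt1P : 1 < #|Z| by rewrite Zp.
exists (fun j => Z :\ (if j == 0 then z0 else z1)); split=> [j|j|z zZ].
- exact: subsetDl.
- by apply/eqP; rewrite -eqSS -Zp [#|Z|](cardsD1 (if j == 0 then z0 else z1)); case: ifP; rewrite ?z0Z ?z1Z.
have [->|zz0] := eqVneq z z0; first by exists 1; rewrite ?double_gt0 // !inE z01.
by exists 0; rewrite // !inE zz0.
Qed.

(** For every set [S] of at least [m] vertices there is a hypergraph on [S]
    satisfying [associated_prime_crit]: a single edge if [S] has [m] elements,
    and otherwise a padded odd cycle, whose length is chosen so that [m - 2] or
    [m - 1] vertices remain for the padding. *)
Lemma exists_hypergraph m n (S : {set 'I_n}) : 3 <= m -> m <= #|S| ->
  exists (H : hypergraph m n) (B : {set 'I_n}),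
  [/\ forall e, e \in edges H -> e \subset S,
      forall C : {set 'I_n}, C \subset B -> vertex_cover H C ->
        ~~ vertex_cover H (B :\: C) &
      forall i, i \in S -> exists C : {set 'I_n},
        [/\ C \subset B, vertex_cover H C & vertex_cover H (i |: B :\: C)]].
Proof.
move=> m3 mS; have [v0 v0S] : exists v0, v0 \in S.
  by apply/card_gt0P; apply: leq_trans mS; apply: leq_trans m3.
move: mS; rewrite leq_eqVlt => /orP[/eqP mS|mS].
  have cS (e : {set 'I_n}) : e \in [set S]%SET -> #|e| = m by rewrite inE => /eqP->.
  pose H := Hypergraph cS; have HC (C : {set 'I_n}) i : i \in C -> i \in S -> vertex_cover H C.
    by move=> iC iS; apply/vertex_coverP => e; rewrite inE => /eqP->; exists i.
  exists H, [set v0]%SET; split=> [e|C CB HC1|i iS].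
  - by rewrite inE => /eqP->.
  - have S1 : S \in edges H by rewrite inE.
    have [i iC _] := elimT (vertex_coverP _ _) HC1 S S1.
    apply/negP => /vertex_coverP/(_ S S1)[j]; rewrite !inE => /andP[jC /eqP jv].
    by have := fintype.subsetP CB _ iC; rewrite inE => /eqP iv; rewrite jv -iv iC in jC.
  - by exists [set v0]%SET; split=> //; [apply: (HC _ v0)|apply: (HC _ i)];
      rewrite // !inE eqxx.
(* The cycle has [2 * k + 1] vertices, which leaves [m - 1] vertices of [S] if
   [#|S| - m] is even and [m - 2] if it is odd. *)
pose k := uphalf (#|S| - m).
have k0 : 0 < k by rewrite /k; lia.
have kS : k.*2 < #|S| by rewrite /k; lia.
pose v := nth v0 (enum S).
have vS i : i <= k.*2 -> v i \in S.
  by move=> ik; rewrite -mem_enum mem_nth // -cardE; apply: leq_ltn_trans kS.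
have v_inj i j : i <= k.*2 -> j <= k.*2 -> v i = v j -> i = j.
  have lt_size x : x <= k.*2 -> x < size (enum S).
    by move=> xk; rewrite -cardE; apply: leq_ltn_trans kS.
  by move=> /lt_size iS /lt_size jS /eqP; rewrite nth_uniq ?enum_uniq // => /eqP.
pose B := [set v j | j : 'I_k.*2.+1]%SET.
have BS : B \subset S by apply/fintype.subsetP => _ /imsetP[x _ ->]; rewrite vS // -ltnS.
have cB : #|B| = k.*2.+1.
  rewrite card_in_imset ?card_ord // => x y _ _ /v_inj xy.
  by apply/val_inj/xy; rewrite -ltnS.
have [|||W [WS cW coverW]] := @exists_padding n (S :\: B) m.-2 k; rewrite //; try lia.
  by rewrite cardsDS // cB /k; lia.
have cW2 j : #|W j|.+2 = m by rewrite cW; lia.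
exists (odd_cycle_hypergraph v_inj k0 WS cW2), B; split.
- exact: odd_cycle_edgeS.
- exact: odd_cycle_no_cover.
- exact: odd_cycle_add_cover.
Qed.

Theorem theorem2p6 (K : fieldType) (n m : nat) (hm : (3 <= m)%N)
    (hmn : (m <= n)%N) (P : set {mpoly K[n]}) (hP : monomial_prime P) :
  (exists H : hypergraph m n,
     associated_prime
       (ideal_mul (edge_ideal_dual K H) (edge_ideal_dual K H)) P)
  <-> height_ge P m.
Proof.
have [S ->] := monomial_prime_var hP; rewrite height_var_ideal.
split=> [[H]|mS]; first exact: associated_prime_card.
have [H [B [HS noC adC]]] := exists_hypergraph hm mS.
by exists H; apply: associated_prime_crit HS noC adC.
Qed.
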